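(* Let $U,W$ be $\mathbb{F}_q$-subspaces of $V=\mathbb{F}_{q^n}^r$ with $\dim_{\mathbb{F}_q}U=\dim_{\mathbb{F}_q}W=rn-n$ and $L_U=L_W$. Let $F_U,F_W\in\mathbb{F}_{q^n}[x_0,\dots,x_{r-1}]$ be their determinantal polynomials. Then $F_W=\lambda F_U$ for some $\lambda\in\mathbb{F}_{q^n}^*$, and $w_{L_U}(P)=w_{L_W}(P)$ for every point $P\in L_U=L_W$.
   Context: $q$ a prime power, $n,r\ge2$. $L_U=\{\langle u\rangle_{\mathbb{F}_{q^n}}:u\in U\setminus\{0\}\}\subseteq\mathrm{PG}(r-1,q^n)$; weight $w_{L_U}(\langle v\rangle)=\dim_{\mathbb{F}_q}(\langle v\rangle_{\mathbb{F}_{q^n}}\cap U)$. Determinantal polynomial: for $u=(u_0,\dots,u_{r-1})$ let $\hat u=(u_0,\dots,u_{r-1},u_0^q,\dots,u_{r-1}^q,\dots,u_0^{q^{n-1}},\dots,u_{r-1}^{q^{n-1}})$; with an $\mathbb{F}_q$-basis $u_1,\dots,u_{rn-n}$ of $U$, $F_U$ is the determinant of the $rn\times rn$ matrix with rows $\hat u_1,\dots,\hat u_{rn-n}$ followed, for $i=0,\dots,n-1$, by the row with $x_0^{q^i},\dots,x_{r-1}^{q^i}$ in positions $ir,\dots,ir+r-1$ and zeros elsewhere. *)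

(* Defs.v *)
From HB Require Import structures.
From mathcomp Require Import all_boot all_algebra all_field.
From mathcomp Require Import mpoly.
Set Implicit Arguments. Unset Strict Implicit. Unset Printing Implicit Defensive.
Import GRing.Theory.
Local Open Scope ring_scope.

(* F plays F_q, L plays F_{q^n} (an extension of F of degree n = \dim {:L}),
   V = L^r is {ffun 'I_r -> L}, viewed as an F-vector space. *)
Section Defs.
Variables (F : finFieldType) (L : fieldExtType F) (r : nat).
Notation V := {ffun 'I_r -> L}.

Definition lscale (c : L) (u : V) : V := [ffun i => c * u i].

Definition same_point (u v : V) : Prop := exists2 c : L, c != 0 & v = lscale c u.

Definition inLU (U : {vspace V}) (v : V) : Prop :=
  v != 0 /\ exists2 u : V, (u \in U) && (u != 0) & same_point u v.

(* <v>_{F_{q^n}} as an F_q-subspace of V: the F-span of {c v : c in an F-basis of L} *)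
Definition Lline (v : V) : {vspace V} :=
  <<[seq lscale c v | c <- vbasis {:L}]>>%VS.

Definition weight (U : {vspace V}) (v : V) : nat := \dim (Lline v :&: U).

Definition qq : nat := #|F|.
Definition nn : nat := \dim {:L}.

Definition coordn (u : V) (j : nat) : L :=
  if insub j is Some j' then u j' else 0.
Definition varn (j : nat) : {mpoly L[r]} :=
  if insub j is Some j' then 'X_j' else 0.

(* determinantal matrix built from the sequence b of (r n - n) vectors:
   row k < rn - n : hat(b_k), i.e. entry in column i r + j is (b_k)_j^(q^i);
   row rn - n + i : x_j^(q^i) in column i r + j, zero elsewhere. *)
Definition detmx (b : seq V) : 'M[{mpoly L[r]}]_(r * nn) :=
  \matrix_(k < r * nn, c < r * nn)
    if (k < r * nn - nn)%N then
      ((coordn (b`_k) (c %% r)) ^+ (qq ^ (c %/ r)))%:MP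
    else if (c %/ r == k - (r * nn - nn))%N then
      varn (c %% r) ^+ (qq ^ (c %/ r))
    else 0.

Definition detpoly (b : seq V) : {mpoly L[r]} := \det (detmx b).

End Defs.

(* Main.v *)
Require Import Defs.
From HB Require Import structures.
From mathcomp Require Import all_boot all_algebra all_field.
From mathcomp Require Import mpoly.
Set Implicit Arguments. Unset Strict Implicit. Unset Printing Implicit Defensive.
Import GRing.Theory.
Local Open Scope ring_scope.

(** Write [n] for the degree of [L] over [F], [q] for the order of [F] and
    [d = 1 + q + ... + q^(n-1)] for the degree of [F_U].  For [v != 0] the matrix
    defining [F_U(v)] is, up to a fixed invertible Moore factor, the matrix of the
    vectors [hat z] with [z] running through a basis of [U] followed by a basis of
    [<v>]; its rank is at most the [F]-dimension of [U + <v>], with equality in the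
    invertible case.  Hence [F_U(v) = 0] exactly when [v] lies on the linear set.
    If [F_U(v) != 0], the change of basis from [U + <v>] to [W + <v>] has entries
    in [F], so [F_W(v) = a F_U(v)] with [a] in [F^*].  Therefore the product of the
    polynomials [F_W - a F_U] over all [a] in [F^*] vanishes on [L^r]; having degree
    [(q - 1) d = q^n - 1 < #|L|], it is the zero polynomial, and one factor vanishes.

    For the weights, choose [y] off the linear set and consider [F_U(v + t y)], of
    degree [d] in [t].  Expanding the determinant over the rows taken from [t y]
    shows that [t] is a root of multiplicity at least [1 + q + ... + q^(w-1)], where
    [w] is the weight of [v + t y].  Counting the nonzero vectors of [U] in the plane
    spanned by [v] and [y] shows that these lower bounds add up to at least [d], so
    they are attained: the weights can be read off the polynomial. *)

(** * Interpolation, determinants, ranks, sums of powers and root multiplicities *)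

Lemma mpoly_eq0_on_grid (R : fieldType) (n : nat) (s : seq R) (p : {mpoly R[n]}) :
  uniq s -> (forall m i, m \in msupp p -> m i < size s)%N ->
  (forall v : 'I_n -> R, (forall i, v i \in s) -> p.@[v] = 0) -> p = 0.
Proof.
move=> s_uniq p_red p0; set N := size s.
(* Inverting the Vandermonde matrix of [s] in every variable writes each coefficient of [p] as a
   combination of its values on the grid. *)
pose a : 'rV[R]_N := \row_i s`_i; pose A := Vandermonde N a.
have A_unit : A \in unitmx.
  rewrite unitmxE det_Vandermonde unitfE; apply/prodf_neq0 => i _.
  apply/prodf_neq0 => j ij; rewrite !mxE subr_eq0 nth_uniq ?ltn_ord //.
  by rewrite neq_ltn ij orbT.
have dual (k m : 'I_N) :
    \sum_(i < N) s`_i ^+ m * invmx A i k = (m == k)%:R.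
  have /matrixP/(_ m k) := mulmxV A_unit; rewrite !mxE => <-.
  by apply: eq_bigr => i _; rewrite !mxE.
apply/eqP; rewrite -msupp_eq0; case E: (msupp p) => [//|k l].
have kp : k \in msupp p by rewrite E inE eqxx.
suff : p@_k = 0 by move/eqP; rewrite mcoeff_eq0 kp.
pose K i : 'I_N := Ordinal (p_red _ i kp).
have -> : p@_k = \sum_(f : {ffun 'I_n -> 'I_N})
    (\prod_i invmx A (f i) (K i)) * p.@[fun i => s`_(f i)].
  under eq_bigr => f _ do rewrite mevalE mulr_sumr.
  rewrite exchange_big /= (bigD1_seq k) ?msupp_uniq //=.
  have step m : m \in msupp p -> \sum_(f : {ffun 'I_n -> 'I_N})
      (\prod_i invmx A (f i) (K i)) * (p@_m * \prod_i s`_(f i) ^+ m i)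
      = p@_m * (m == k)%:R.
    move=> mp; pose M i : 'I_N := Ordinal (p_red _ i mp).
    under eq_bigr => f _ do rewrite mulrCA -big_split /=.
    rewrite -mulr_sumr -(bigA_distr_bigA (fun i j => invmx A j (K i) * s`_j ^+ m i)).
    congr (_ * _).
    under eq_bigr => i _.
      under eq_bigr => j _ do rewrite mulrC -[m i]/(M i : nat).
      rewrite dual; over.
    case: eqVneq => [mk|mk]; last first.
      have /eqP/mnmP nmk := mk.
      have /existsP[i mki] : [exists i, m i != k i].
        rewrite -negb_forall; apply/negP => /forallP h.
        by apply: nmk => i; apply/eqP.
      by rewrite (bigD1 i) //= -val_eqE /= (negPf mki) mul0r.
    by rewrite big1 // => i _; rewrite -val_eqE /= mk eqxx.
  rewrite step // eqxx mulr1 big_seq_cond big1 ?addr0 // => m /andP[mp mk].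
  by rewrite step // (negPf mk) mulr0.
by rewrite big1 // => f _; rewrite p0 ?mulr0 // => i; rewrite mem_nth.
Qed.

(** Multilinearity in the rows: [S] collects the rows where the second summand is chosen. *)
Lemma det_rows_add (R : comNzRingType) (n : nat) (A B : 'M[R]_n) (d : 'I_n -> R) :
  \det (\matrix_(i, j) (A i j + d i * B i j)) =
  \sum_(S : {set 'I_n}) (\prod_(i in S) d i) *
    \det (\matrix_(i, j) if i \in S then B i j else A i j).
Proof.
rewrite /determinant; under [RHS]eq_bigr do rewrite mulr_sumr.
rewrite exchange_big /=; apply: eq_bigr => s _.
under eq_bigr do rewrite mxE addrC.
rewrite bigA_distr mulr_sumr; apply: eq_bigr => S _.
rewrite mulrCA; congr (_ * _); rewrite [X in X * _]big_mkcond -big_split /=.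
by apply: eq_bigr => i _; rewrite mxE; case: ifP; rewrite ?mul1r.
Qed.

Lemma mxrank_rows_support (K : fieldType) (m n : nat) (A : 'M[K]_(m, n)) (S : {set 'I_m}) :
  (forall i, i \notin S -> row i A = 0) -> (\rank A <= #|S|)%N.
Proof.
move=> A0; have -> : #|S| = (\sum_(i in S) 1)%N by rewrite sum1_card.
have sub : (A <= \sum_(i in S) <<row i A>>)%MS.
  apply/row_subP => i; case: (boolP (i \in S)) => [iS|/A0->]; last exact: sub0mx.
  by rewrite (sumsmx_sup i) // genmxE.
apply: leq_trans (mxrankS sub) _; apply: leq_trans (mxrank_sum_leqif _) _.
by rewrite /=; apply: leq_sum => i _; rewrite genmxE rank_leq_row.
Qed.

Lemma mxrank_modify_rows (K : fieldType) (m n : nat) (A B : 'M[K]_(m, n)) (S : {set 'I_m}) :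
  (forall i j, i \notin S -> A i j = B i j) -> (\rank A <= \rank B + #|S|)%N.
Proof.
move=> AB; rewrite -[A](addrNK B) addrC.
apply: leq_trans (mxrank_add _ _) _; rewrite leq_add2l.
apply: mxrank_rows_support => i iS; apply/rowP => j.
by rewrite !mxE AB // subrr.
Qed.

(** Induction on [n]: a selected top index contributes a power that dominates the top term of the
    other sum, since at most [n] indices lie below it. *)
Lemma sum_expn_count (q n : nat) (P : pred nat) (w : nat) : (0 < q)%N ->
  (w <= \sum_(i < n | P i) 1)%N ->
  (\sum_(i < w) q ^ i <= \sum_(i < n | P i) q ^ i)%N.
Proof.
move=> q0; elim: n w => [|n IH] w; first by rewrite !big_ord0 leqn0 => /eqP->; rewrite big_ord0.
have recr (F : nat -> nat) :
    (\sum_(i < n.+1 | P i) F i = \sum_(i < n | P i) F i + if P n then F n else 0)%N.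
  by rewrite big_mkcond big_ord_recr /= -big_mkcond.
rewrite (recr (fun=> 1%N)) (recr (expn q)).
case: (P n) => [|]; last by rewrite !addn0; apply: IH.
have le_n : (\sum_(i < n | P i) 1 <= n)%N.
  by rewrite sum1_card (leq_trans (max_card _)) // card_ord.
case: w => [|w]; first by rewrite big_ord0.
rewrite addn1 ltnS => wn; rewrite big_ord_recr leq_add ?IH //.
by rewrite leq_pexp2l // (leq_trans wn).
Qed.

(** Powers of distinct linear factors are coprime, so their product divides [p]. *)
Lemma sum_mup_lt_size (K : fieldType) (p : {poly K}) (s : seq K) :
  p != 0 -> uniq s -> (\sum_(t <- s) mup t p < size p)%N.
Proof.
move=> p0 us; have dvd : \prod_(t <- s) ('X - t%:P) ^+ mup t p %| p.
  elim: s us => [|t s IH] /=; first by rewrite big_nil dvd1p.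
  case/andP=> ts us; rewrite big_cons Gauss_dvdp ?IH // ?andbT -?mup_geq //.
  apply: coprimep_expl; rewrite coprimep_sym coprimep_XsubC.
  rewrite rootE horner_prod prodf_seq_neq0; apply/allP => u uins /=.
  rewrite horner_exp expf_neq0 // hornerXsubC subr_eq0.
  by apply: contraNneq ts => ->.
apply: leq_trans (dvdp_leq p0 dvd).
rewrite (eq_leq (_ : _ = size _)) //.
rewrite size_prod_seq; last by move=> t _; rewrite expf_neq0 // polyXsubC_eq0.
under [in RHS]eq_bigr do rewrite size_exp_XsubC -addn1.
by rewrite big_split /= sum1_size -addSn addnK.
Qed.

(** * Frobenius powers over the finite field *)

Section Frobenius.
Variables (F : finFieldType) (L : fieldExtType F).
Local Notation q := #|F|.
Local Notation n := (\dim {:L}).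

Lemma pnat_card_finField (k : nat) : [pchar L].-nat (q ^ k)%N.
Proof.
have [p p_pr pF] := finPcharP F.
have /(pi_pnat (_ : p.-nat _)) : p \in [pchar L] by rewrite pchar_lalg.
apply; rewrite pnatX; apply/orP; left.
by rewrite (card_pprimeChar pF) pnatX pnat_id.
Qed.

Lemma frobD (k : nat) (x y : L) : (x + y) ^+ (q ^ k) = x ^+ (q ^ k) + y ^+ (q ^ k).
Proof. exact/exprDn_pchar/pnat_card_finField. Qed.

Lemma frob_polyD (k : nat) (x y : {poly L}) :
  (x + y) ^+ (q ^ k) = x ^+ (q ^ k) + y ^+ (q ^ k).
Proof.
apply: exprDn_pchar; rewrite (eq_pnat _ (@pchar_poly L)).
exact: pnat_card_finField.
Qed.

Lemma expf_card_iter (k : nat) (a : F) : a ^+ (q ^ k) = a.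
Proof. by elim: k => // k IH; rewrite expnS mulnC exprM IH expf_card. Qed.

Lemma frobZ (k : nat) (a : F) (x : L) : (a *: x) ^+ (q ^ k) = a *: x ^+ (q ^ k).
Proof. by rewrite exprZn expf_card_iter. Qed.

Lemma expn_card_gt0 (k : nat) : (0 < q ^ k)%N.
Proof. by rewrite expn_gt0 ltnW // finNzRing_gt1. Qed.

Lemma frob_sumZ (k : nat) (I : finType) (a : I -> F) (x : I -> L) :
  (\sum_i a i *: x i) ^+ (q ^ k) = \sum_i a i *: x i ^+ (q ^ k).
Proof.
apply: (big_rec2 (fun y z => y ^+ (q ^ k) = z)).
  by rewrite expr0n gtn_eqF ?expn_card_gt0.
by move=> i y z _ <-; rewrite frobD frobZ.
Qed.

(** [L] is declared only as an extension of [F]; its finiteness comes through the copy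
    [finvect_type L]. *)
Definition elements : seq L := enum (finvect_type L).

Lemma elements_uniq : uniq elements.
Proof. exact: enum_uniq. Qed.

Lemma size_elements : size elements = (q ^ n)%N.
Proof.
transitivity #|finvect_type L|; first by rewrite cardE.
rewrite -(card_vspacef (Vector.class (finvect_type L))).
exact: card_vspace.
Qed.

Lemma poly_eq0_on_elements (p : {poly L}) :
  (size p <= q ^ n)%N -> (forall a, p.[a] = 0) -> p = 0.
Proof.
move=> szp p0; apply/eqP; apply: contraLR szp => pn0; rewrite -ltnNge -size_elements.
apply: max_poly_roots pn0 _ elements_uniq; apply/allP => a _.
by rewrite rootE p0.
Qed.

(** The combination is a polynomial of degree below q^n having all q^n elements of [L] as roots. The
    predicate [P] and exponent map [e] allow use on a selection of matrix columns. *)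
Lemma frob_independent (I : finType) (P : pred I) (e : I -> nat) (x : I -> L) :
  {in P &, injective e} -> (forall i, P i -> e i < n)%N ->
  (forall a, \sum_(i | P i) x i * a ^+ (q ^ e i) = 0) -> forall i, P i -> x i = 0.
Proof.
move=> e_inj e_lt x0; pose p : {poly L} := \sum_(i | P i) x i *: 'X^(q ^ e i).
have p0 : p = 0.
  apply: poly_eq0_on_elements => [|a].
    apply: (leq_trans (size_sum _ _ _)); apply/bigmax_leqP => i Pi.
    apply: leq_trans (size_scale_leq _ _) _; rewrite size_polyXn.
    by rewrite ltn_exp2l ?e_lt ?finNzRing_gt1.
  by rewrite horner_sum -[RHS](x0 a); apply: eq_bigr => i _; rewrite !hornerE.
move=> i Pi; have := congr1 (fun r : {poly L} => r`_(q ^ e i)) p0.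
rewrite /= coef0 coef_sum (bigD1 i) //= coefZ coefXn eqxx mulr1.
rewrite big1 ?addr0 // => j /andP[Pj ji]; rewrite coefZ coefXn.
rewrite eqn_exp2l ?finNzRing_gt1 // (_ : (e i == e j) = false) ?mulr0 //.
by apply: contraNF ji => /eqP/e_inj->.
Qed.

End Frobenius.

(** * Hat vectors, their matrices, and the points of projective space *)

Section HatMatrices.
Variables (F : finFieldType) (L : fieldExtType F) (r : nat).
Local Notation V := {ffun 'I_r -> L}.
Local Notation q := #|F|.
Local Notation n := (\dim {:L}).
Implicit Types (u v : V) (U W : {vspace V}).

Lemma coordnE u (j : 'I_r) : coordn u j = u j.
Proof. by rewrite /coordn valK. Qed.

Lemma coordn_sumZ (I : finType) (a : I -> F) (u : I -> V) j :
  coordn (\sum_i a i *: u i) j = \sum_i a i *: coordn (u i) j.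
Proof.
rewrite /coordn; case: insubP => [k _ _|_]; last by rewrite big1 // => i _; rewrite scaler0.
by rewrite sum_ffunE; apply: eq_bigr => i _; rewrite ffunE.
Qed.

Lemma dim_ffun_full : \dim {:V} = (r * n)%N.
Proof. by rewrite !dimvf /dim /= card_ord mulnC. Qed.

Lemma ord_mul_gt0 (c : 'I_(r * n)) : (0 < r)%N.
Proof. by case: r c => // -[]. Qed.

Lemma col_lt (c : 'I_(r * n)) : (c %/ r < n)%N.
Proof. by rewrite ltn_divLR ?(ord_mul_gt0 c) // [(n * r)%N]mulnC ltn_ord. Qed.

Definition hat u : 'rV[L]_(r * n) := \row_c coordn u (c %% r) ^+ (q ^ (c %/ r)).

Definition hatmx m (s : seq V) : 'M[L]_(m, r * n) := \matrix_(k < m) hat s`_k.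

(** Frobenius powers are additive and fix [F], so [hat] is [F]-linear. *)
Lemma hat_sumZ (I : finType) (a : I -> F) (u : I -> V) :
  hat (\sum_i a i *: u i) = \sum_i (a i)%:A *: hat (u i).
Proof.
apply/rowP => c; rewrite summxE !mxE coordn_sumZ frob_sumZ.
by apply: eq_bigr => i _; rewrite !mxE mulr_algl.
Qed.

Lemma rank_hatmx m (s : seq V) : (\rank (hatmx m s) <= \dim <<s>>)%N.
Proof.
apply: leq_trans (rank_leq_row (hatmx (\dim <<s>>) (vbasis <<s>>))).
apply: mxrankS; apply/row_subP => k; rewrite rowK.
have : s`_k \in <<s>>%VS.
  have [ks|ks] := ltnP k (size s); first by rewrite memv_span ?mem_nth.
  by rewrite nth_default ?mem0v.
move/coord_vbasis->; rewrite hat_sumZ; apply: summx_sub => i _.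
by apply: scalemx_sub; apply: (eq_row_sub i); rewrite rowK.
Qed.

Lemma hat_separates (x : 'I_(r * n) -> L) :
  (forall u, \sum_c x c * hat u 0 c = 0) -> forall c, x c = 0.
Proof.
move=> x0 c0; have r0 := ord_mul_gt0 c0.
pose j : 'I_r := Ordinal (ltn_pmod c0 r0).
apply: (@frob_independent _ _ _ (fun c : 'I_(r * n) => c %% r == j)%N
  (fun c : 'I_(r * n) => c %/ r)%N x); rewrite ?eqxx //.
- move=> c c' /eqP cj /eqP c'j cc'; apply/val_inj => /=.
  by rewrite (divn_eq c r) (divn_eq c' r) cj c'j cc'.
- by move=> c _; apply: col_lt.
(* Test vectors supported on coordinate [j] kill the columns outside that residue class mod [r],
   leaving distinct Frobenius powers of [a]. *)
move=> a; have := x0 [ffun i => if i == j then a else 0].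
rewrite (bigID (fun c : 'I_(r * n) => c %% r == j)%N) /=.
rewrite [X in _ + X]big1 ?addr0 => [h|c cj].
  by rewrite -[RHS]h; apply: eq_bigr => c /eqP cj; rewrite mxE (cj : _ = val j) coordnE ffunE eqxx.
pose k : 'I_r := Ordinal (ltn_pmod c r0).
rewrite mxE -[(c %% r)%N]/(val k) coordnE ffunE -val_eqE /= (negPf cj).
by rewrite expr0n gtn_eqF ?expn_card_gt0 // mulr0.
Qed.

(** A vector killing the hats of a basis kills all hats by [F]-linearity, hence is zero by
    [hat_separates]. *)
Lemma hatmx_unit (s : seq V) :
  size s = (r * n)%N -> basis_of {:V} s -> hatmx (r * n) s \in unitmx.
Proof.
move=> sz sB; rewrite -unitmx_tr -row_free_unit; apply: inj_row_free => x xs.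
apply/rowP => c; rewrite [RHS]mxE; apply: (hat_separates (x := x 0)) => u.
have sB' : basis_of {:V} (in_tuple s) by [].
have := memvf u; move/(coord_basis sB')->; rewrite hat_sumZ.
under eq_bigr do rewrite summxE mulr_sumr.
rewrite exchange_big big1 // => i _ /=.
under eq_bigr do rewrite mxE mulrCA.
rewrite -mulr_sumr.
have iN : (i < r * n)%N by rewrite -sz ltn_ord.
have := congr1 (fun A : 'rV_(r * n) => A 0 (Ordinal iN)) xs.
rewrite !mxE => xs0; rewrite (_ : \sum_(_ < _) _ = 0) ?mulr0 // -[RHS]xs0.
by apply: eq_bigr => c' _; rewrite !mxE.
Qed.

(** The transition matrix has entries in [F], not just in [L]; this later forces ratios of
    determinants into [F]. *)
Lemma hatmx_coord (s s' : seq V) :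
  basis_of {:V} s -> size s = (r * n)%N -> exists C : 'M[F]_(r * n),
    hatmx (r * n) s' = map_mx (in_alg L) C *m hatmx (r * n) s.
Proof.
move=> sB sz; have sT : size s == (r * n)%N by rewrite sz.
have sB' : basis_of {:V} (Tuple sT) by [].
exists (\matrix_(k, l) coord (Tuple sT) l s'`_k).
apply/row_matrixP => k; rewrite rowK row_mul [s'`_k in LHS](coord_basis sB') ?memvf //.
rewrite hat_sumZ mulmx_sum_row; apply: eq_bigr => l _.
by rewrite rowK !mxE.
Qed.

Lemma lscale_sumZ (I : finType) (a : I -> F) (c : I -> L) v :
  lscale (\sum_i a i *: c i) v = \sum_i a i *: lscale (c i) v.
Proof.
apply/ffunP => j; rewrite ffunE sum_ffunE mulr_suml.
by apply: eq_bigr => i _; rewrite !ffunE scalerAl.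
Qed.

Lemma mem_Lline u v : (u \in Lline v) <-> exists c, u = lscale c v.
Proof.
pose s := [tuple of [seq lscale c v | c <- vbasis {:L}]].
split=> [|[c ->]].
  move/(coord_span (X := s))->; exists (\sum_i coord s i u *: (vbasis {:L})`_i).
  by rewrite lscale_sumZ; apply: eq_bigr => i _; rewrite (nth_map 0) ?size_tuple.
rewrite (coord_vbasis (memvf c)) lscale_sumZ; apply: rpred_sum => i _.
apply/rpredZ/memv_span/map_f; exact/mem_nth/(leq_trans (ltn_ord i))/eq_leq/esym/size_tuple.
Qed.

Lemma lscale_eq0 c v : (lscale c v == 0) = (c == 0) || (v == 0).
Proof.
apply/eqP/orP => [|[]/eqP->]; last 2 first.
- by apply/ffunP => i; rewrite !ffunE mul0r.
- by apply/ffunP => i; rewrite !ffunE mulr0.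
move/ffunP => h; case: eqVneq => [|c0]; first by left.
right; apply/eqP/ffunP => i; have /eqP := h i.
by rewrite !ffunE mulf_eq0 (negPf c0) => /eqP.
Qed.

Lemma lscale0 v : lscale 0 v = 0.
Proof. by apply/eqP; rewrite lscale_eq0 eqxx. Qed.

Lemma lscaleA a b v : lscale a (lscale b v) = lscale (a * b) v.
Proof. by apply/ffunP => i; rewrite !ffunE mulrA. Qed.

Lemma lscale1 v : lscale 1 v = v.
Proof. by apply/ffunP => i; rewrite !ffunE mul1r. Qed.

Lemma lscaleDr a u v : lscale a (u + v) = lscale a u + lscale a v.
Proof. by apply/ffunP => i; rewrite !ffunE mulrDr. Qed.

Lemma lscaleN a v : lscale (- a) v = - lscale a v.
Proof. by apply/ffunP => i; rewrite !ffunE mulNr. Qed.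

Lemma dim_Lline v : v != 0 -> \dim (Lline v) = n.
Proof.
move=> v0; pose s := [tuple of [seq lscale c v | c <- vbasis {:L}]].
rewrite -(size_tuple s); apply/eqP.
change (free s); apply/freeP => k.
rewrite (_ : \sum_(i < _) _ = lscale (\sum_i k i *: (vbasis {:L})`_i) v).
  move/eqP; rewrite lscale_eq0 (negPf v0) orbF => /eqP.
  have /freeP := basis_free (vbasisP {:L}); exact.
by rewrite lscale_sumZ; apply: eq_bigr => i _; rewrite (nth_map 0) ?size_tuple.
Qed.

Lemma inLU_weight U v : inLU U v <-> v != 0 /\ (0 < weight U v)%N.
Proof.
rewrite /weight lt0n dimv_eq0; split=> [[v0 [u /andP[uU u0] [c c0 vE]]]|[v0 nz]].
  split=> //; apply/eqP => I0.
  have : u \in (Lline v :&: U)%VS.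
    rewrite memv_cap uU andbT; apply/mem_Lline; exists c^-1.
    by rewrite vE lscaleA mulVf // lscale1.
  by rewrite I0 memv0 (negPf u0).
have := memv_pick (Lline v :&: U); rewrite memv_cap => /andP[/mem_Lline[c uE] uU].
move: nz; rewrite -vpick0; set u := vpick _ in uE uU * => u0.
split=> //; exists u; first by rewrite uU.
have c0 : c != 0 by move: u0; rewrite uE lscale_eq0 negb_or => /andP[].
by exists c^-1; rewrite ?invr_eq0 // uE lscaleA mulVf // lscale1.
Qed.

Lemma dim_add_Lline U v : v != 0 -> (\dim (U + Lline v) + weight U v = \dim U + n)%N.
Proof. by move=> v0; rewrite /weight capvC dimv_sum_cap dim_Lline. Qed.

End HatMatrices.

(** * The determinantal polynomial: values, zeros and proportionality *)

Lemma dhomog_det (R : comNzRingType) (r m : nat) (A : 'M[{mpoly R[r]}]_m) (e : 'I_m -> nat) :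
  (forall i j, A i j \is (e i).-homog) -> \det A \is (\sum_i e i).-homog.
Proof.
move=> Ah; apply: rpred_sum => s _; rewrite mulr_sign.
set p := \prod_(i < m) _; have Ph : p \is (\sum_i e i).-homog.
  apply: (big_rec2 (fun (p : {mpoly R[r]}) k => p \is k.-homog)); first exact: dhomog1.
  by move=> i k p' _; apply: dhomogM.
by case: ifP => _; rewrite ?rpredN.
Qed.

Section DeterminantalPolynomial.
Variables (F : finFieldType) (L : fieldExtType F) (r : nat).
Local Notation V := {ffun 'I_r -> L}.
Local Notation q := #|F|.
Local Notation n := (\dim {:L}).
Local Notation N := (r * n)%N.
Local Notation M := (N - n)%N.
Local Notation degF := (\sum_(i < n) q ^ i)%N.
Implicit Types (u v : V) (U W : {vspace V}) (b : seq V).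

(** An arbitrary substitution serves both evaluation at a vector and restriction to a line. *)
Lemma mmap_detpoly (S : comNzRingType) (f : {rmorphism L -> S}) (h : 'I_r -> S) b :
  mmap f h (detpoly b) = \det (\matrix_(k < N, c < N)
    if (k < M)%N then f (hat b`_k 0 c)
    else if (c %/ r == k - M)%N then
      (if insub (c %% r)%N is Some j then h j else 0) ^+ (q ^ (c %/ r))
    else 0).
Proof.
rewrite /detpoly -det_map_mx; congr (\det _); apply/matrixP => k c; rewrite !mxE.
case: ifP => _; first by rewrite /= mmapC.
case: ifP => _; last exact: mmap0.
rewrite rmorphXn /= /varn; congr (_ ^+ _).
by case: insubP => [j _ _|_]; rewrite ?mmap0 // mmapX mmap1U.
Qed.

Definition evmx b v : 'M[L]_N := \matrix_(k < N, c < N)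
  if (k < M)%N then hat b`_k 0 c
  else if (c %/ r == k - M)%N then hat v 0 c else 0.

Lemma meval_detpoly b v : (detpoly b).@[v] = \det (evmx b v).
Proof.
rewrite /meval mmap_detpoly; congr (\det _); apply/matrixP => k c; by rewrite !mxE.
Qed.

(** Block diagonal: the identity of size [M], then the Moore matrix of an [F]-basis of [L]. *)
Definition moore_block : 'M[L]_N := \matrix_(k < N, l < N)
  if (k < M)%N then (k == l)%:R
  else if (l < M)%N then 0 else (vbasis {:L})`_(k - M) ^+ (q ^ (l - M)).

Hypothesis r_gt1 : (1 < r)%N.
Let r0 : (0 < r)%N. Proof. exact: ltnW. Qed.

Lemma leq_dim_mul : (n <= N)%N.
Proof. by rewrite leq_pmull. Qed.

Lemma row_index_lt (k : 'I_N) : (M <= k -> k - M < n)%N.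
Proof. by move=> Mk; rewrite ltn_subLR // subnK ?leq_dim_mul. Qed.

(** The identity block kills the first [M] entries of a kernel vector; the others give a combination
    of Frobenius powers vanishing on a basis of [L], hence everywhere. *)
Lemma moore_block_unit : moore_block \in unitmx.
Proof.
rewrite -unitmx_tr -row_free_unit; apply: inj_row_free => x xT.
have xT0 (k : 'I_N) : \sum_l x 0 l * moore_block k l = 0.
  have := congr1 (fun A : 'rV_N => A 0 k) xT; rewrite !mxE => h; rewrite -[RHS]h.
  by apply: eq_bigr => l _; rewrite !mxE.
have xlow (k : 'I_N) : (k < M)%N -> x 0 k = 0.
  move=> kM; rewrite -[RHS](xT0 k) (bigD1 k) //= mxE kM eqxx mulr1 big1 ?addr0 // => l lk.
  by rewrite mxE kM eq_sym (negPf lk) mulr0.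
apply/rowP => c; rewrite [RHS]mxE; have [/xlow//|Mc] := ltnP c M.
apply: (@frob_independent _ L _ (fun c : 'I_N => M <= c)%N (fun c : 'I_N => c - M)%N (x 0)) => //.
- move=> i j Mi Mj ij; apply/val_inj => /=.
  by rewrite -(subnK Mi) -(subnK Mj) ij.
- by move=> i; apply: row_index_lt.
move=> a; rewrite (coord_vbasis (memvf a)).
under eq_bigr do rewrite frob_sumZ mulr_sumr.
rewrite exchange_big big1 //= => i _.
under eq_bigr do rewrite -scalerAr.
rewrite -scaler_sumr (_ : \sum_(_ < _ | _) _ = 0) ?scaler0 //.
have iN : (M + i < N)%N by rewrite -[X in (_ < X)%N](subnK leq_dim_mul) ltn_add2l.
rewrite -[RHS](xT0 (Ordinal iN)) [RHS](bigID (fun c : 'I_N => M <= c)%N) /=.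
rewrite [X in _ = _ + X]big1 ?addr0 => [|l]; last first.
  by rewrite -ltnNge => lM; rewrite mxE /= ltnNge leq_addr lM mulr0.
by apply: eq_bigr => l Ml; rewrite mxE /= ltnNge leq_addr /= ltnNge Ml /= addKn.
Qed.

Definition with_line b v : seq V := b ++ [seq lscale c v | c <- vbasis {:L}].

Lemma size_with_line b v : size b = M -> size (with_line b v) = N.
Proof. by move=> sb; rewrite size_cat size_map size_tuple sb subnK ?leq_dim_mul. Qed.

Lemma span_with_line b v : <<with_line b v>>%VS = (<<b>> + Lline v)%VS.
Proof. exact: span_cat. Qed.

(** Passing from [v] to [lscale c v] multiplies the i-th block of the hat by c^(q^i), and these
    scalars form the Moore block. *)
Lemma moore_block_mul b v : size b = M ->
  hatmx N (with_line b v) = moore_block *m evmx b v.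
Proof.
move=> sb; apply/matrixP => k c; rewrite [LHS]mxE [RHS]mxE nth_cat sb.
have [kM|Mk] := ltnP k M.
  rewrite (bigD1 k) //= big1 ?addr0 => [|l lk]; last first.
    by rewrite mxE kM eq_sym (negPf lk) mul0r.
  by rewrite ![in RHS]mxE kM eqxx mul1r mxE.
(* In column [c], the only one of the last rows of [evmx b v] that can be nonzero is
   [M + c %/ r]. *)
have cN : (c %/ r + M < N)%N.
  by rewrite -[X in (_ < X)%N](subnK leq_dim_mul) addnC ltn_add2l col_lt.
rewrite (bigD1 (Ordinal cN)) //= big1 ?addr0 => [|l lc]; last first.
  rewrite mxE ltnNge Mk /=; case: ltnP => lM; first by rewrite mul0r.
  rewrite mxE ltnNge lM /=; case: eqP => [cl|]; last by rewrite mulr0.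
  by case/eqP: lc; apply/val_inj; rewrite /= cl subnK.
rewrite ![in RHS]mxE /= ltnNge Mk /= ltnNge leq_addl /= addnK eqxx.
rewrite (nth_map 0) ?size_tuple ?row_index_lt //.
rewrite mxE -exprMn; congr (_ ^+ _).
by rewrite -[(c %% r)%N]/(val (Ordinal (ltn_pmod c r0))) !coordnE ffunE.
Qed.

Lemma rank_evmx U b v : size b = M -> <<b>>%VS = U -> (\rank (evmx b v) <= \dim (U + Lline v))%N.
Proof.
move=> sb bU; rewrite -bU -span_with_line.
apply: leq_trans (rank_hatmx N _).
by rewrite moore_block_mul // eqmxMfull // row_full_unit moore_block_unit.
Qed.

Lemma basis_size U b : basis_of U b -> \dim U = M -> size b = M.
Proof. by case/andP=> /eqP <- /eqP <-. Qed.

Lemma with_line_basis U b v : basis_of U b -> \dim U = M -> \dim (U + Lline v) = N ->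
  basis_of {:V} (with_line b v).
Proof.
move=> bB dU dN; rewrite basisEdim size_with_line ?(basis_size bB) // dim_ffun_full leqnn andbT.
by rewrite span_with_line (span_basis bB) -dimv_leqif_sup ?subvf // dim_ffun_full dN.
Qed.

Lemma detpoly_neq0P U b v : basis_of U b -> \dim U = M ->
  ((detpoly b).@[v] != 0) = (\dim (U + Lline v) == N).
Proof.
move=> bB dU; have sb := basis_size bB dU.
have sE := span_basis bB; rewrite meval_detpoly -unitfE -unitmxE; apply/idP/idP => [ev|/eqP dN].
  rewrite eqn_leq -{1}dim_ffun_full dimvS ?subvf //=.
  by apply: leq_trans (rank_evmx v sb sE); rewrite (mxrank_unit ev).
suff : hatmx N (with_line b v) \in unitmx.
  by rewrite moore_block_mul // unitmx_mul => /andP[].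
apply: hatmx_unit; first exact: size_with_line.
exact: with_line_basis bB dU dN.
Qed.

(** Both hat matrices carry the same Moore factor, which cancels; the scalar is the determinant of
    the transition matrix and may be zero at this stage. *)
Lemma detpoly_eval_ratio bU bW U v : basis_of U bU -> \dim U = M -> size bW = M ->
  (detpoly bU).@[v] != 0 ->
  exists a : F, (detpoly bW).@[v] = a%:A * (detpoly bU).@[v].
Proof.
move=> bB dU sW ev; have sb := basis_size bB dU.
move: (ev); rewrite (detpoly_neq0P v bB dU) => /eqP dN.
have zB := with_line_basis bB dU dN.
have [C CE] := hatmx_coord (with_line bW v) zB (size_with_line v sb).
exists (\det C); have := congr1 determinant CE.
rewrite !moore_block_mul // !det_mulmx det_map_mx -!meval_detpoly mulrCA.
by apply: mulfI; rewrite -unitfE -unitmxE moore_block_unit.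
Qed.

Lemma sum_row_degrees (f : nat -> nat) :
  (\sum_(k < N) (if k < M then 0 else f (k - M)) = \sum_(i < n) f i)%N.
Proof.
rewrite -(big_mkord xpredT (fun k => if k < M then 0 else f (k - M))%N).
rewrite (big_cat_nat (n := M)) ?leq_subr //= big_nat_cond big1 ?add0n => [|k]; last first.
  by rewrite andbT /= => ->.
rewrite -{1}[M]add0n big_addn subKn ?leq_dim_mul // big_mkord.
by apply: eq_bigr => i _; rewrite addnK ltnNge leq_addl.
Qed.

Lemma detpoly_homog b : detpoly b \is degF.-homog.
Proof.
rewrite -(sum_row_degrees (expn q)); apply: dhomog_det => k c; rewrite mxE.
case: ifP => kM.
  by rewrite -[_%:MP]mulr1 mul_mpolyC dhomogZ ?dhomog1.
case: eqP => [->|_]; last exact: dhomog0.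
rewrite -{2}[(q ^ _)%N]mul1n; apply: dhomogMn; rewrite /varn.
by case: insubP => [j _ _|_]; rewrite ?dhomog0 // dhomogX /= mdeg1.
Qed.

Lemma detpoly_proportional U W bU bW : basis_of U bU -> basis_of W bW ->
  \dim U = M -> \dim W = M -> (forall v, inLU U v <-> inLU W v) ->
  exists2 a : F, a != 0 & detpoly bW = a%:A *: detpoly bU.
Proof.
move=> bBU bBW dU dW UW.
have sW := basis_size bBW dW.
have zeroUW v : ((detpoly bU).@[v] != 0) = ((detpoly bW).@[v] != 0).
  apply: (etrans (detpoly_neq0P v bBU dU)); apply: esym.
  apply: (etrans (detpoly_neq0P v bBW dW)).
  (* At [v = 0] the sums reduce to [U] and [W], of equal dimension. *)
  have [->|v0] := eqVneq v 0.
    have -> : Lline (0 : V) = 0%VS.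
      apply/eqP; rewrite -subv0; apply/subvP => u /mem_Lline[c ->].
      by rewrite memv0 lscale_eq0 eqxx orbT.
    by rewrite !addv0 dU dW.
  have wUW : (0 < weight U v)%N = (0 < weight W v)%N.
    apply/idP/idP => w0.
      by have /UW/inLU_weight[] : inLU U v by apply/inLU_weight.
    by have /UW/inLU_weight[] : inLU W v by apply/inLU_weight.
  have E (X : {vspace V}) : \dim X = M -> (\dim (X + Lline v) == N) = ~~ (0 < weight X v)%N.
    move=> dX; have := dim_add_Lline X v0; rewrite dX subnK ?leq_dim_mul // => <-.
    by rewrite -{1}[\dim _]addn0 eqn_add2l eq_sym lt0n negbK.
  by rewrite !E // wUW.
pose P := \prod_(a : F | a != 0) (detpoly bW - a%:A *: detpoly bU).
suff : P = 0.
  move/eqP; rewrite prodf_seq_eq0 => /hasP[a _ /andP[a0]].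
  by rewrite subr_eq0 => /eqP E; exists a.
have Ph : P \is (#|F|.-1 * degF).-homog.
  have -> : (#|F|.-1 * degF = \sum_(a : F | a != 0%R) degF)%N.
    by rewrite sum_nat_const cardC1.
  apply: (big_rec2 (fun (p : {mpoly L[r]}) k => p \is k.-homog)); first exact: dhomog1.
  move=> a k p _; apply: dhomogM.
  by rewrite rpredB ?dhomogZ ?detpoly_homog.
(* The total degree bounds the exponent of each single variable. *)
apply: (mpoly_eq0_on_grid (elements_uniq L)) => [m i mP|v _].
  rewrite size_elements -[X in (_ < X)%N]prednK ?expn_card_gt0 // predn_exp ltnS.
  by rewrite -(dhomog_mf Ph mP) /= mdegE (bigD1 i) //= leq_addr.
pose u : V := [ffun i => v i].
have -> : P.@[v] = P.@[u] by apply: meval_eq => i; rewrite ffunE.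
apply/eqP; rewrite rmorph_prod prodf_seq_eq0; apply/hasP.
(* Where F_U vanishes so does F_W, hence every factor does; [1] is one admissible scalar. *)
have [U0|U0] := eqVneq (detpoly bU).@[u] 0.
  exists 1; rewrite ?mem_index_enum // oner_eq0 /= mevalB mevalZ U0 mulr0 subr0.
  by rewrite -[_ == 0]negbK -zeroUW U0 eqxx.
have [a E] := detpoly_eval_ratio bBU dU sW U0.
(* Nonvanishing of F_W at [u] makes [a] nonzero, so its factor occurs in the product. *)
have W0 := U0; rewrite zeroUW E in W0.
exists a; rewrite ?mem_index_enum //= mevalB mevalZ E subrr eqxx andbT.
by apply: contraNneq W0 => ->; rewrite scale0r mul0r.
Qed.

End DeterminantalPolynomial.

(** * Geometric sums and a union bound *)

Lemma sum_expn_uniq (q : nat) (s : seq nat) : (0 < q)%N -> uniq s ->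
  (\sum_(i < size s) q ^ i <= \sum_(x <- s) q ^ x)%N.
Proof.
move=> q0 us; pose m := (\max_(x <- s) x).+1.
have s_lt x : x \in s -> (x < m)%N by move=> xs; rewrite ltnS leq_bigmax_seq.
(* Listing [s] as a filtered range reduces the claim to [sum_expn_count]. *)
have sE : perm_eq s [seq x <- index_iota 0 m | x \in s].
  apply: uniq_perm => //; first by rewrite filter_uniq ?iota_uniq.
  move=> x; rewrite mem_filter mem_index_iota /=.
  by case: (boolP (x \in s)) => // /s_lt.
rewrite (perm_big _ sE) big_filter big_mkord; apply: sum_expn_count => //.
by rewrite -(big_mkord (mem s) (fun=> 1%N)) -big_filter sum1_size (perm_size sE).
Qed.

(** Multiplying by q - 1 turns the sums into q^w - 1. Thus the sum determines [w], which recovers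
    weights from multiplicities. *)
Lemma leq_sum_expn (q w w' : nat) : (1 < q)%N ->
  (\sum_(i < w) q ^ i <= \sum_(i < w') q ^ i)%N = (w <= w')%N.
Proof.
move=> q1; rewrite -(@leq_pmul2l q.-1); last by case: q q1 => [|[]].
rewrite -!predn_exp -ltnS !prednK ?expn_gt0 ?(ltnW q1) // leq_exp2l //.
Qed.

Lemma card_bigcup_le (T I : finType) (A : I -> {set T}) :
  (#|\bigcup_i A i| <= \sum_i #|A i|)%N.
Proof.
apply: (big_rec2 (fun (X : {set T}) m => #|X| <= m)%N); first by rewrite cards0.
move=> i m X _ le; apply: leq_trans (leq_add (leqnn _) le).
by rewrite cardsU leq_subr.
Qed.

(** * Weights as root multiplicities along a line *)

Section Weights.
Variables (F : finFieldType) (L : fieldExtType F) (r : nat).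
Local Notation V := {ffun 'I_r -> L}.
Local Notation q := #|F|.
Local Notation n := (\dim {:L}).
Local Notation N := (r * n)%N.
Local Notation M := (N - n)%N.
Local Notation degF := (\sum_(i < n) q ^ i)%N.
Local Notation fV := (finvect_type V).
Local Notation fL := (finvect_type L).
Implicit Types (u v y : V) (U W : {vspace V}) (b : seq V).

Let q_gt1 : (1 < q)%N. Proof. exact: finNzRing_gt1. Qed.

(** F_U restricted to the affine line v + X y, as a polynomial in the parameter. *)
Definition linepoly b v y : {poly L} :=
  mmap polyC (fun j => (v j)%:P + (y j)%:P * 'X) (detpoly b).

Definition mixmx b v y (S : {set 'I_N}) : 'M[L]_N :=
  \matrix_(k, c) if k \in S then evmx b y k c else evmx b v k c.

Definition last_rows : {set 'I_N} := [set k : 'I_N | (M <= k)%N].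

(** Row M + i is additive in the point, and its part from X y carries the factor X^(q^i); [S]
    records the rows taken from X y. *)
Lemma linepoly_expand b v y : linepoly b v y =
  \sum_(S : {set 'I_N} | S \subset last_rows)
    'X^(\sum_(k in S) q ^ (k - M)) * (\det (mixmx b v y S))%:P.
Proof.
(* [D] is zero on the constant rows, so only sets inside [last_rows] survive. *)
pose D (k : 'I_N) : {poly L} := if (k < M)%N then 0 else 'X^(q ^ (k - M)).
rewrite /linepoly mmap_detpoly.
transitivity (\det (\matrix_(k, c) (map_mx polyC (evmx b v) k c +
                 D k * map_mx polyC (evmx b y) k c))).
  congr (\det _); apply/matrixP => k c; rewrite !mxE /D.
  case: ifP => _; first by rewrite mul0r addr0.
  case: eqP => [<-|_]; last by rewrite polyC0 mulr0 addr0.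
  rewrite /coordn; case: insubP => [j _ _|_].
    by rewrite frob_polyD exprMn !rmorphXn mulrC.
  by rewrite !expr0n gtn_eqF ?expn_card_gt0 // polyC0 mulr0 addr0.
rewrite det_rows_add (bigID (fun S : {set 'I_N} => S \subset last_rows)) /=.
rewrite [X in _ + X]big1 ?addr0 => [|S]; last first.
  case/subsetPn => k kS; rewrite inE -ltnNge => kM.
  by rewrite (bigD1 k) //= /D kM !mul0r.
apply: eq_bigr => S /subsetP SL; congr (_ * _).
  rewrite -prodrXr; apply: eq_bigr => k /SL.
  by rewrite inE /D ltnNge => ->.
rewrite -det_map_mx; congr (\det _); apply/matrixP => k c; rewrite !mxE.
by case: ifP.
Qed.

Hypothesis r_gt1 : (1 < r)%N.

Lemma sum_last_rows : (\sum_(k in last_rows) q ^ (k - M) = degF)%N.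
Proof.
rewrite -(sum_row_degrees L r_gt1 (expn q)) big_mkcond; apply: eq_bigr => k _.
by rewrite inE ltnNge; case: (M <= k)%N.
Qed.

(** Only [last_rows] itself reaches the exponent [degF], and its mixed matrix is [evmx b y]. *)
Lemma linepoly_lead b v y : exists2 p : {poly L}, (size p <= degF)%N &
  linepoly b v y = p + (detpoly b).@[y] *: 'X^degF.
Proof.
rewrite linepoly_expand (bigD1 last_rows) //= addrC sum_last_rows.
eexists; last first.
  congr (_ + _); rewrite -mul_polyC mulrC; congr (_%:P * _).
  rewrite meval_detpoly; congr (\det _); apply/matrixP => k c; rewrite !mxE.
  by rewrite inE leqNgt; case: (k < M)%N.
apply: (leq_trans (size_sum _ _ _)); apply/bigmax_leqP => S /andP[SL SnL].
rewrite mulrC mul_polyC; apply: leq_trans (size_scale_leq _ _) _; rewrite size_polyXn.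
rewrite -sum_last_rows [X in (_ < X)%N](bigID (fun k => k \in S)) /=.
rewrite [X in (_ < X + _)%N](eq_bigl (fun k => k \in S)) => [|k]; last first.
  by rewrite andb_idl // => /(subsetP SL).
have /subsetPn[k kL kS] : ~~ (last_rows \subset S) by rewrite eqEsubset SL in SnL.
by rewrite -addn1 leq_add2l (bigD1 k) /= ?kL // (leq_trans (expn_card_gt0 F (k - M))) ?leq_addr.
Qed.

(** Let w be the weight of [v]. Changing fewer than w rows of [evmx b v], of rank at most N - w,
    leaves a singular matrix; with w or more rows in [S], the exponent of X is a sum of at least w
    distinct powers of [q]. *)
Lemma dvd_linepoly U b v y : basis_of U b -> \dim U = M -> v != 0 ->
  'X^(\sum_(i < weight U v) q ^ i) %| linepoly b v y.
Proof.
move=> bB dU v0; rewrite linepoly_expand.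
apply: (big_ind (fun p => 'X^(\sum_(i < weight U v) q ^ i) %| p)) => [||S SL].
- exact: dvdp0.
- by move=> p p'; apply: dvdp_add.
have [lt_Sw|le_wS] := ltnP #|S| (weight U v).
  rewrite (_ : \det _ = 0) ?polyC0 ?mulr0 ?dvdp0 //; apply/eqP.
  rewrite -[_ == 0]negbK -unitfE -unitmxE -row_free_unit -row_leq_rank -ltnNge.
  have := mxrank_modify_rows (A := mixmx b v y S) (B := evmx b v) (S := S).
  move/(_ _)/leq_ltn_trans; apply; first by move=> k c kS; rewrite mxE (negPf kS).
  have := rank_evmx r_gt1 v (basis_size bB dU) (span_basis bB).
  have := dim_add_Lline U v0; rewrite dU subnK ?leq_dim_mul // => dN le_r.
  by rewrite -[X in (_ < X)%N]dN -addnS leq_add.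
apply: dvdp_mulr; rewrite dvdp_Pexp2l ?size_polyX //.
pose s := [seq (k - M)%N | k : 'I_N <- enum S].
have -> : (\sum_(k in S) q ^ (k - M) = \sum_(x <- s) q ^ x)%N.
  by rewrite big_map big_enum.
apply: (leq_trans _ (sum_expn_uniq _ _)); rewrite ?(ltnW q_gt1) //.
  by rewrite leq_sum_expn // size_map -cardE.
rewrite map_inj_in_uniq ?enum_uniq // => k k'.
rewrite !mem_enum => /(subsetP SL) + /(subsetP SL); rewrite !inE => Mk Mk' kk'.
by apply/val_inj; rewrite /= -(subnK Mk) -(subnK Mk') kk'.
Qed.

(** Carries the bound at the root 0 for base point v + t y to the root [t] for base point [v]. *)
Lemma linepoly_shift b v y t :
  linepoly b (v + lscale t y) y \Po ('X - t%:P) = linepoly b v y.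
Proof.
rewrite /linepoly /mmap raddf_sum; apply: eq_bigr => m _.
rewrite /= comp_polyM comp_polyC; congr (_ * _).
rewrite /mmap1 (rmorph_prod (comp_poly _)); apply: eq_bigr => j _ /=.
rewrite rmorphXn /=; congr (_ ^+ _).
rewrite comp_polyD comp_polyM !comp_polyC comp_polyX !ffunE.
by rewrite polyCD polyCM mulrBr [t%:P * _]mulrC -addrA; congr (_ + _); rewrite addrC subrK.
Qed.

Lemma card_nonzero U : #|[set u : fV | (u \in U) && (u != 0)]| = (q ^ \dim U).-1.
Proof.
have <- : #|[pred u : fV | u \in U]| = (q ^ \dim U)%N.
  exact: (@card_vspace F fV (Vector.class fV) U).
rewrite [in RHS](cardD1 (0 : fV)) inE mem0v /=.
by apply: eq_card => u; rewrite !inE andbC.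
Qed.

(** At most (q^n - 1)(q^M - 1) vectors are products c u with c and u nonzero, fewer than the q^N - 1
    nonzero vectors. *)
Lemma exists_notin_linear_set U : (0 < n)%N -> \dim U = M ->
  exists2 y : V, y != 0 & weight U y = 0%N.
Proof.
move=> n0 dU.
pose A := [set u : fV | (u \in U) && (u != 0)]; pose B := [set c : fL | c != 0].
pose f (x : fL * fV) : fV := lscale x.1 x.2.
have cB : #|B| = (q ^ n).-1.
  have -> : (q ^ n)%N = #|fL| by rewrite -(size_elements L) cardE.
  by rewrite [in RHS](cardD1 (0 : fL)) inE /=; apply: eq_card => c; rewrite !inE andbT.
have cV : #|[set u : fV | u != 0]| = (q ^ N).-1.
  rewrite -(dim_ffun_full L r) -card_nonzero; apply: eq_card => u.
  by rewrite !inE memvf.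
have lt : (#|f @: setX B A| < #|[set u : fV | u != 0%R]|)%N.
  apply: leq_ltn_trans (leq_imset_card _ _) _.
  rewrite cardsX cB cV card_nonzero dU.
  rewrite -[X in (_ < (q ^ X).-1)%N](subnK (leq_dim_mul L r_gt1)) expnD.
  have : (1 < q ^ n)%N by rewrite -(exp1n n) ltn_exp2r.
  have : (1 < q ^ M)%N.
    rewrite -(exp1n M) ltn_exp2r // subn_gt0 -[X in (X < _)%N]mul1n.
    by rewrite ltn_pmul2r.
  case: (q ^ M)%N => [|[|a]] // _; case: (q ^ n)%N => [|[|c]] // _ /=.
  by rewrite plusE ltnS mulnC (leq_trans _ (leq_addl c _)) // leq_pmul2l.
have /subsetPn[y] : ~~ ([set u : fV | u != 0%R] \subset f @: setX B A).
  by apply: contraL lt => /subset_leq_card; rewrite -leqNgt.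
rewrite inE => y0 yf; exists y => //; apply/eqP; rewrite -leqn0 leqNgt.
apply: contra yf => w0; have [_ [u uU [c c0 yE]]] : inLU U y by apply/inLU_weight.
by apply/imsetP; exists (c, u); rewrite ?inE ?c0.
Qed.


Lemma sum_card_points U v y : \dim U = M -> y != 0 -> weight U y = 0%N ->
  (forall t, v + lscale t y != 0) ->
  (degF <= \sum_(t : fL) \sum_(i < weight U (v + lscale t y)%R) q ^ i)%N.
Proof.
move=> dU y0 wy vy.
have v0 : v != 0 by have := vy 0; rewrite lscale0 addr0.
pose P := (Lline v + Lline y)%VS.
(* By [vy], no multiple of [y] equals [v], so the two points are distinct. *)
have capvy : (Lline v :&: Lline y = 0)%VS.
  apply/eqP; rewrite -subv0; apply/subvP => u; rewrite memv_cap memv0.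
  case/andP=> /mem_Lline[a uE] /mem_Lline[c uE'].
  rewrite uE lscale_eq0 (negPf v0) orbF; apply: contraT => a0.
  have := vy (- (a^-1 * c)); rewrite lscaleN -lscaleA -uE' uE lscaleA mulVf // lscale1.
  by rewrite subrr eqxx.
have dP : \dim P = (n + n)%N by rewrite dimv_disjoint_sum // !dim_Lline.
(* dim U + dim P - dim V = M + 2n - N = n. *)
have dUP : (n <= \dim (U :&: P))%N.
  rewrite -(leq_add2l (\dim (U + P))) dimv_sum_cap dU dP addnA subnK ?leq_dim_mul //.
  by rewrite leq_add2r -(dim_ffun_full L r) dimvS ?subvf.
(* After multiplication by q - 1 both sides count nonzero vectors. *)
rewrite -(@leq_pmul2l q.-1); last by case: q q_gt1 => [|[]].
rewrite -predn_exp big_distrr /=.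
under eq_bigr do rewrite -predn_exp /weight -card_nonzero.
apply: (leq_trans _ (card_bigcup_le _)).
apply: (@leq_trans (q ^ \dim (U :&: P)).-1).
  by rewrite -!subn1 leq_sub2r // leq_exp2l.
rewrite -card_nonzero; apply/subset_leq_card/subsetP => u; rewrite inE memv_cap.
case/andP=> /andP[uU /memv_addP[w /mem_Lline[a wE] [z /mem_Lline[c zE] uE]]] u0.
have a0 : a != 0.
  apply: contraNneq u0 => a0.
  have u_line : u \in (Lline y :&: U)%VS.
    rewrite memv_cap uU andbT uE wE a0 lscale0 add0r.
    by apply/mem_Lline; exists c.
  move/eqP: wy; rewrite /weight dimv_eq0 => /eqP wy.
  by rewrite wy memv0 in u_line.
(* Since u = a (v + (c / a) y), the parameter is c / a. *)
apply/bigcupP; exists (a^-1 * c : fL) => //; rewrite inE u0 andbT memv_cap uU andbT.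
apply/mem_Lline; exists a.
by rewrite lscaleDr lscaleA mulVKf // uE wE zE.
Qed.

Lemma mup_linepoly U b v y : basis_of U b -> \dim U = M -> y != 0 -> weight U y = 0%N ->
  (forall t, v + lscale t y != 0) ->
  linepoly b v y != 0 /\ mup 0 (linepoly b v y) = (\sum_(i < weight U v) q ^ i)%N.
Proof.
move=> bB dU y0 wy vy; have [p szp pE] := linepoly_lead b v y.
have Fy : (detpoly b).@[y] != 0.
  rewrite (detpoly_neq0P r_gt1 _ bB dU) -[\dim _]addn0 -wy dim_add_Lline // dU.
  by rewrite subnK ?leq_dim_mul.
set f := linepoly b v y in pE *.
(* The leading coefficient F_U(y) is nonzero, so the degree is exactly [degF]. *)
have szf : size f = degF.+1.
  rewrite pE addrC size_polyDl size_scale ?size_polyXn //.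
have f0 : f != 0 by rewrite -size_poly_eq0 szf.
split=> //.
pose E (t : fL) := (\sum_(i < weight U (v + lscale t y)%R) q ^ i)%N.
have leE t : (E t <= mup t f)%N.
  rewrite mup_geq // -[f](linepoly_shift b v y t).
  have := dvd_linepoly y bB dU (vy t) => /(dvdp_comp_poly ('X - t%:P)).
  by rewrite rmorphXn /= comp_polyX.
have sum_mup : (\sum_(t : fL) mup t f <= degF)%N.
  by rewrite -big_enum -ltnS -szf; exact: sum_mup_lt_size f0 (elements_uniq L).
(* Equality of the two sums forces equality term by term; the term at 0 is the claim. *)
have /leqif_sum : forall t : fL, true -> (E t <= mup t f ?= iff (E t == mup t f))%N.
  by move=> t _; split.
case=> _ /esym; rewrite eqn_leq leq_sum //= (leq_trans sum_mup) ?sum_card_points //.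
move/forallP/(_ 0)/eqP => <-; by rewrite /E lscale0 addr0.
Qed.

End Weights.

(** * Proportionality and equality of weights *)

Theorem mainTheorem4 (F : finFieldType) (L : fieldExtType F) (r : nat)
    (U W : {vspace {ffun 'I_r -> L}}) (bU bW : seq {ffun 'I_r -> L}) :
  (2 <= r)%N -> (2 <= \dim {:L})%N ->
  \dim U = (r * \dim {:L} - \dim {:L})%N ->
  \dim W = (r * \dim {:L} - \dim {:L})%N ->
  (forall v, inLU U v <-> inLU W v) ->
  basis_of U bU -> basis_of W bW ->
  (exists2 lam : L, lam != 0 & detpoly bW = lam *: detpoly bU) /\
  (forall v, inLU U v -> weight U v = weight W v).
Proof.
move=> r1 n1 dU dW UW bBU bBW.
have [a a0 FE] := detpoly_proportional r1 bBU bBW dU dW UW.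
have aL0 : a%:A != 0 :> L by rewrite scaler_eq0 (negPf a0) oner_eq0.
split=> [|v vU]; first by exists a%:A.
have [y y0 wUy] := exists_notin_linear_set r1 (ltnW n1) dU.
have wWy : weight W y = 0%N.
  apply/eqP; rewrite -leqn0 leqNgt; apply/negP => wW.
  have /UW/inLU_weight[_] : inLU W y by apply/inLU_weight.
  by rewrite wUy.
(* A zero of v + t y would put [y] on the point of [v], hence on the linear set. *)
have vy t : v + lscale t y != 0.
  apply/eqP => vE; have [v0 [u uU [c c0 E]]] := vU.
  have t0 : t != 0.
    by apply: contraNneq v0 => t0; rewrite -vE t0 lscale0 addr0.
  have /inLU_weight[_] : inLU U y; last by rewrite wUy.
  split=> //; exists u => //; exists (- t^-1 * c); first by rewrite mulf_neq0 ?oppr_eq0 ?invr_eq0.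
  rewrite -lscaleA -E (_ : v = - lscale t y); last by apply/eqP; rewrite -addr_eq0 vE.
  by rewrite -lscaleN lscaleA mulrNN mulVf // lscale1.
have [fU0 mU] := mup_linepoly r1 bBU dU y0 wUy vy.
have [fW0 mW] := mup_linepoly r1 bBW dW y0 wWy vy.
have q1 := finNzRing_gt1 F.
(* A nonzero scalar factor leaves multiplicities unchanged. *)
have mUW : mup 0 (linepoly bW v y) = mup 0 (linepoly bU v y).
  by rewrite /linepoly FE mmapZ mupMr // rootC.
have E := etrans (esym mW) (etrans mUW mU); apply/eqP.
by rewrite eqn_leq -!(leq_sum_expn (weight _ v) (weight _ v) q1) E leqnn.
Qed.
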